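(* Let $f\in(0,1)$ be a target frequency, $\epsilon>0$, $K,P\in\mathbb{Z}_{\ge1}$, and $\eta_g,\eta_s\in(0,1)$. Let $c$ be a candidate pattern whose true frequency $f_c\in[0,1]$ is the fraction of data owners whose local data contain $c$. Suppose $c$ has been responded to in $m_c\ge 1$ rounds, in each of which $P$ data owners respond, so $n_c=Pm_c$, and its accumulated response is $$r_c=\sum_{k=1}^{n_c} B_k+\sum_{\ell=1}^{m_c} G_\ell,$$ where $B_1,\dots,B_{n_c}$ are i.i.d. Bernoulli$(f_c)$ random variables (indicators that the sampled responding data owners contain $c$), $G_1,\dots,G_{m_c}$ are i.i.d. two-sided geometric random variables with parameter $\alpha=e^{-\epsilon/K}$, and the $B_k$ are independent of the $G_\ell$. Then $c$ is a frequent pattern (i.e. $f_c\ge f$) with confidence $(1-\eta_g)(1-\eta_s)$ when $$\frac{r_c}{n_c}-\sqrt{\frac{2e^{-\epsilon/K}}{2(1-e^{-\epsilon/K})^2P^2m_c\eta_g}}-\sqrt{\frac{\ln\eta_s}{-2n_c}}\ \ge\ f;$$ that is, with probability at least $(1-\eta_g)(1-\eta_s)$ one has $f_c\ge \frac{r_c}{n_c}-\sqrt{\frac{2e^{-\epsilon/K}}{2(1-e^{-\epsilon/K})^2P^2m_c\eta_g}}-\sqrt{\frac{\ln\eta_s}{-2n_c}}$, so that whenever the left-hand side of the displayed inequality is at least $f$, $f_c\ge f$.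
   Context: A two-sided geometric random variable $G(\alpha)$, $\alpha\in(0,1)$, has $\mathbb{P}(G(\alpha)=x)=\frac{1-\alpha}{1+\alpha}\alpha^{|x|}$ for $x\in\mathbb{Z}$; it arises as the aggregate of the distributed Pólya noises added by the $P$ responders of a candidate in one round. A pattern is frequent if its frequency among the data owners is at least the target frequency $f$. *)

(* Defs.v *)
From HB Require Import structures.
From mathcomp Require Import all_boot all_order all_algebra.
From mathcomp Require Import all_classical all_reals all_analysis.
Set Implicit Arguments. Unset Strict Implicit. Unset Printing Implicit Defensive.
Import Order.TTheory GRing.Theory Num.Theory.
Local Open Scope classical_set_scope.
Local Open Scope ring_scope.

(* Mutual independence of a finite family of real random variables
   (X i)_{i : I}: for every choice of Borel sets (A i)_i the joint
   probability factorizes.  Choosing A i = setT for i outside J gives the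
   factorization for every subfamily J. *)
Definition mutually_independent d (T : measurableType d) (R : realType)
  (Pr : probability T R) (I : finType) (X : I -> T -> R) : Prop :=
  forall A : I -> set R, (forall i, measurable (A i)) ->
    Pr (\bigcap_(i in [set: I]) (X i @^-1` A i)) =
    (\prod_(i : I) Pr (X i @^-1` A i))%E.

Definition bernoulli_law d (T : measurableType d) (R : realType)
  (Pr : probability T R) (X : T -> R) (p : R) : Prop :=
  Pr (X @^-1` [set 1]) = p%:E /\ Pr (X @^-1` [set 0]) = (1 - p)%:E.

Definition two_sided_geometric_law d (T : measurableType d) (R : realType)
  (Pr : probability T R) (X : T -> R) (alpha : R) : Prop :=
  forall x : int, Pr (X @^-1` [set x%:~R]) =
    ((1 - alpha) / (1 + alpha) * alpha ^+ `|x|%N)%:E.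

(* Main.v *)
Require Import Defs.
From HB Require Import structures.
From mathcomp Require Import all_boot all_order all_algebra.
From mathcomp Require Import all_classical all_reals all_analysis.
From mathcomp Require Import measurable_realfun.
From mathcomp Require Import ring lra.
Set Implicit Arguments.
Unset Strict Implicit.
Unset Printing Implicit Defensive.
Import Order.TTheory GRing.Theory Num.Theory.
Import numFieldNormedType.Exports.
Local Open Scope classical_set_scope.
Local Open Scope ring_scope.

(** The noise [G_1 + ... + G_m] and the sampling error [B_1 + ... + B_n - n * fc]
    are independent, so it suffices to bound each from above by its threshold: the
    first with probability at least [1 - eta_g] by Chebyshev's inequality, where the
    symmetry of the noise halves the two-sided bound, and the second with
    probability at least [1 - eta_s] by Hoeffding's inequality.  Both are inequalities
    between finite sums over the atoms of the joint law, once each [G_l] is confined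
    to a window [-N, N]; the mass lost in this way tends to [0] as [N] grows. *)

(** * Hoeffding's inequality for Bernoulli sums *)

Lemma ge0_of_derive_ge0 (R : realType) (g dg : R -> R) :
  (forall x : R, is_derive x 1 g (dg x)) -> (forall x, 0 <= x -> 0 <= dg x) ->
  g 0 = 0 -> forall x, 0 <= x -> 0 <= g x.
Proof.
move=> gD dg_ge0 g0 x x_ge0.
have [|c] := @MVT_segment R g dg 0 x x_ge0 (fun y _ => gD y).
  apply: continuous_subspaceT => y.
  exact/differentiable_continuous/derivable1_diffP/(@ex_derive _ _ _ _ _ _ _ (gD y)).
rewrite in_itv /= g0 !subr0 => /andP[c_ge0 _] ->.
by rewrite mulr_ge0 ?dg_ge0.
Qed.

(** Hoeffding's lemma. The log-ratio [g] of the two sides vanishes at 0 together with its derivative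
    [g1], and its second derivative is [1/4 - v * (1 - v)], where [v = p * expR x / D x] is the
    tilted success probability. *)
Lemma bernoulli_mgf_le (R : realType) (p l : R) : 0 <= p <= 1 -> 0 <= l ->
  1 - p + p * expR l <= expR (p * l + l ^+ 2 / 8).
Proof.
move=> /andP[p_ge0 p_le1] l_ge0.
pose D (x : R) := 1 - p + p * expR x.
have D_gt0 x : 0 < D x.
  rewrite /D; have := expR_gt0 x.
  by have [->|p_neq0] := eqVneq p 0 => ?; [lra|have : 0 < p by rewrite lt0r p_neq0]; nra.
have DD (x : R) : is_derive x 1 D (p * expR x).
  by apply: is_derive_eq; rewrite add0r mul1r.
pose g1 (x : R) := p + x / 4 - p * expR x / D x.
have g1D (x : R) : is_derive x 1 g1 (4^-1 - p * (1 - p) * expR x / D x ^+ 2).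
  have Dn0 : D x != 0 by rewrite gt_eqF.
  have ? : is_derive x 1 (fun y => (D y)^-1) (- (D x) ^- 2 *: (p * expR x)).
    exact: is_deriveV.
  apply: is_derive_eq.
  by rewrite /GRing.scale /=; rewrite /D in Dn0 *; field.
have g1_ge0 x : 0 <= x -> 0 <= g1 x.
  apply: (ge0_of_derive_ge0 g1D).
    move=> y _; rewrite subr_ge0 ler_pdivrMr ?exprn_gt0 // /D.
    (* This square equals [D y ^+ 2 - 4 * p * (1 - p) * expR y]. *)
    have := sqr_ge0 (1 - p - p * expR y); lra.
  by rewrite /g1 /D expR0 mulr1 subrK divr1 mul0r addr0 subrr.
pose g (x : R) := p * x + x ^+ 2 / 8 - ln (D x).
have gD (x : R) : is_derive x 1 g (g1 x).
  have lnD : is_derive x 1 (@ln R \o D) ((D x)^-1 * (p * expR x)).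
    by apply: is_derive1_comp; exact: is_derive1_ln.
  have sqD : is_derive x 1 (fun y : R => p * y + y ^+ 2 / 8) (p + x / 4).
    by apply: is_derive_eq; rewrite /GRing.scale /=; lra.
  by apply: is_derive_eq; rewrite /g1 (mulrC (_^-1)).
have : 0 <= g l.
  apply: (ge0_of_derive_ge0 gD g1_ge0) => //.
  by rewrite /g /D expR0 mulr1 subrK ln1 mulr0 expr0n /= mul0r addr0 subrr.
rewrite subr_ge0 => gl; rewrite -[leLHS](@lnK R) ?posrE ?D_gt0 //.
by rewrite ler_expR.
Qed.

Lemma sum_ffun_prod (R : comPzRingType) (I V : finType) (F : I -> V -> R) :
  \sum_(w : {ffun I -> V}) \prod_i F i (w i) = \prod_i \sum_v F i v.
Proof. by rewrite bigA_distr_bigA. Qed.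

(** The probability is kept as a weighted sum over outcome vectors, so that it can later be
    multiplied by the analogous sum for the noise. *)
Lemma hoeffding_bernoulli (R : realType) (n : nat) (p t : R) :
  0 <= p <= 1 -> 0 <= t ->
  1 - expR (- 2 * n%:R * t ^+ 2) <=
  \sum_(u : {ffun 'I_n -> bool} | \sum_k (u k)%:R <= n%:R * (p + t))
     \prod_k (if u k then p else 1 - p).
Proof.
move=> p01 t_ge0; have /andP[p_ge0 p_le1] := p01.
pose good (u : {ffun 'I_n -> bool}) := \sum_k (u k)%:R <= n%:R * (p + t).
pose w (u : {ffun 'I_n -> bool}) := \prod_k (if u k then p else 1 - p).
have w_ge0 u : 0 <= w u.
  by apply: prodr_ge0 => k _; case: ifP => _ //; rewrite subr_ge0.
have total : \sum_u w u = 1.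
  rewrite (sum_ffun_prod (fun (_ : 'I_n) b => if b then p else 1 - p)).
  by rewrite big1 // => i _; rewrite big_bool /= addrC subrK.
suff : \sum_(u | ~~ good u) w u <= expR (- 2 * n%:R * t ^+ 2).
  move: total; rewrite (bigID good) /=.
  by move=> total bad; rewrite lerBlDr -[leLHS]total lerD2l.
(* Markov's inequality for the exponential moment at the optimal [4 * t] *)
pose tilt (b : bool) := if b then p * expR (4 * t) else 1 - p.
pose c := expR (- 4 * t * (n%:R * (p + t))).
apply: (@le_trans _ _ (\sum_(u : {ffun 'I_n -> bool}) c * \prod_k tilt (u k))).
  rewrite [leRHS](bigID good) /=.
  apply: ler_wpDl.
    apply: sumr_ge0 => u _; rewrite mulr_ge0 ?expR_ge0 // prodr_ge0 // => k _.
    by rewrite /tilt; case: ifP => _; rewrite ?subr_ge0 // mulr_ge0 ?expR_ge0.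
  apply: ler_sum => u; rewrite /good -ltNge => u_bad.
  have -> : \prod_k tilt (u k) = w u * expR (4 * t * \sum_k (u k)%:R).
    rewrite mulr_sumr expR_sum -big_split /=; apply: eq_bigr => k _.
    by rewrite /tilt; case: (u k); rewrite ?mulr1 // mulr0 expR0 mulr1.
  (* A bad vector exceeds the threshold, so its tilted weight is [w u] times a factor at least 1. *)
  rewrite mulrCA ler_peMr // /c -expRD -[leLHS]expR0 ler_expR.
  nra.
rewrite -mulr_sumr (sum_ffun_prod (fun _ : 'I_n => tilt)).
have mgf : p * expR (4 * t) + (1 - p) <= expR (p * (4 * t) + (4 * t) ^+ 2 / 8).
  by rewrite addrC bernoulli_mgf_le // mulr_ge0.
apply: (@le_trans _ _ (c * \prod_(k < n) expR (p * (4 * t) + (4 * t) ^+ 2 / 8))).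
  rewrite ler_wpM2l ?expR_ge0 //; apply: ler_prod => k _; rewrite big_bool /= mgf andbT.
  by rewrite addr_ge0 ?subr_ge0 // mulr_ge0 ?expR_ge0.
rewrite prodr_const card_ord -expRM_natl /c -expRD ler_expR.
by rewrite le_eqVlt; apply/orP; left; apply/eqP; field.
Qed.

(** * Chebyshev's inequality for symmetric noise *)

(** Negating every coordinate preserves weights and exchanges the two tails, so the second moment
    pays for twice the upper tail. The total mass may be below 1 because the lemma is applied to a
    truncated law. *)
Lemma symmetric_chebyshev (R : realFieldType) (m : nat) (V : finType)
  (q x : V -> R) (neg : V -> V) (s : R) :
  involutive neg -> (forall v, q (neg v) = q v) -> (forall v, x (neg v) = - x v) ->
  (forall v, 0 <= q v) -> \sum_v q v <= 1 -> 0 <= s ->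
  2 * s ^+ 2 * (\sum_(w : {ffun 'I_m -> V} | s < \sum_l x (w l)) \prod_l q (w l))
   <= m%:R * \sum_v q v * x v ^+ 2.
Proof.
move=> negK q_even x_odd q_ge0 mass s_ge0.
pose W (w : {ffun 'I_m -> V}) := \prod_l q (w l).
pose S (w : {ffun 'I_m -> V}) := \sum_l x (w l).
have W_ge0 w : 0 <= W w by apply: prodr_ge0.
pose N (w : {ffun 'I_m -> V}) : {ffun 'I_m -> V} := [ffun l => neg (w l)].
have NK : involutive N by move=> w; apply/ffunP => l; rewrite !ffunE negK.
have WN w : W (N w) = W w by apply: eq_bigr => l _; rewrite ffunE.
have SN w : S (N w) = - S w.
  by rewrite /S -sumrN; apply: eq_bigr => l _; rewrite ffunE.
have swap : \sum_(w | s < S w) W w = \sum_(w | S w < - s) W w.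
  rewrite (reindex_inj (inv_inj NK)) /=.
  by apply: eq_big => w; rewrite ?WN // SN ltrNr.
have second_moment : \sum_w S w ^+ 2 * W w <= m%:R * \sum_v q v * x v ^+ 2.
  have S2 w : S w ^+ 2 * W w = \sum_(i < m) \sum_(j < m) x (w i) * x (w j) * W w.
    rewrite expr2 /S mulr_suml mulr_suml; apply: eq_bigr => i _.
    by rewrite mulr_sumr mulr_suml.
  under eq_bigr => w _ do rewrite S2.
  rewrite exchange_big /= -[m in m%:R]card_ord -sumr_const mulr_suml.
  apply: ler_sum => i _; rewrite mul1r exchange_big /= (bigD1 i) //=.
  rewrite [X in _ + X]big1 ?addr0 => [|j ji].
    (* The diagonal term factors into the second moment at [i] and the masses of the other
       coordinates, each at most 1. *)
    pose F (k : 'I_m) v := if k == i then q v * x v ^+ 2 else q v.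
    rewrite (_ : \sum_w _ = \sum_(w : {ffun 'I_m -> V}) \prod_k F k (w k)); last first.
      apply: eq_bigr => w _; rewrite /W (bigD1 i) //= [in RHS](bigD1 i) //= {1}/F eqxx.
      rewrite -expr2 mulrA (mulrC (q _)); congr (_ * _).
      by apply: eq_bigr => k /negbTE ki; rewrite /F ki.
    rewrite sum_ffun_prod (bigD1 i) //= {1}/F eqxx ler_piMr //.
      by apply: sumr_ge0 => v _; rewrite mulr_ge0 ?sqr_ge0.
    apply: numdomain.Num.Theory.prodr_ile1 => k /negbTE ki; rewrite /F ki mass andbT.
    exact: sumr_ge0.
  (* for [i != j] the factor at [i] is [\sum_v q v * x v], which vanishes by symmetry *)
  pose F (k : 'I_m) v := q v * (if k == i then x v else 1) * (if k == j then x v else 1).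
  rewrite (_ : \sum_w _ = \sum_(w : {ffun 'I_m -> V}) \prod_k F k (w k)); last first.
    apply: eq_bigr => w _; rewrite /F !big_split /= mulrC mulrA; congr (_ * _ * _).
      by rewrite -big_mkcond big_pred1_eq.
    by rewrite -big_mkcond big_pred1_eq.
  rewrite sum_ffun_prod (bigD1 i) //= {1}/F eqxx eq_sym (negbTE ji).
  set z := (X in X * _); suff -> : z = 0 by rewrite mul0r.
  apply/eqP; suff : z + z == 0 by rewrite -mulr2n mulrn_eq0.
  rewrite {2}/z (reindex_inj (inv_inj negK)) /=.
  rewrite /z -big_split big1 //= => v _.
  by rewrite q_even x_odd !mulr1 mulrN subrr.
apply: le_trans second_moment.
rewrite mulrC mulrA mulr_natr mulr2n [X in (X + _) * _]/= {2}swap.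
rewrite mulrDl !mulr_suml.
rewrite big_mkcond [X in _ + X]big_mkcond -big_split /=.
apply: ler_sum => w _; rewrite [leRHS]mulrC.
(* Since [0 <= s], the two tails exclude each other, and on either one [s ^+ 2 <= S w ^+ 2]. *)
case: ifPn => [sS|_]; case: ifPn => [Ss|_] /=.
- by move: sS Ss; rewrite -/(S w) => sS Ss; lra.
- rewrite addr0; move: sS; rewrite -/(S w) => sS.
  by rewrite -/(W w) ler_wpM2l ?W_ge0 //; nra.
- rewrite add0r; move: Ss; rewrite -/(S w) => Ss.
  by rewrite -/(W w) ler_wpM2l ?W_ge0 //; nra.
- by rewrite addr0 mulr_ge0 ?sqr_ge0.
Qed.

(** * From weights of atoms to probabilities *)

(** Independence on singletons gives the probability of each atom [E j], and distinct value vectors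
    give disjoint atoms. Being only a lower bound, it lets the atoms outside the window be
    dropped. *)
Lemma le_sum_atoms d (T : measurableType d) (R : realType)
  (Pr : probability T R) (I J : finType) (X : I -> T -> R) (y : J -> I -> R)
  (Q : pred J) (A : set T) :
  (forall i, measurable_fun setT (X i)) -> mutually_independent Pr X ->
  (forall j j', y j =1 y j' -> j = j') ->
  measurable A ->
  (forall j t, Q j -> (forall i, X i t = y j i) -> A t) ->
  (\sum_(j | Q j) \prod_i Pr (X i @^-1` [set y j i]) <= Pr A)%E.
Proof.
move=> mX indX y_inj mA subA.
pose E j := \bigcap_(i in [set: I]) (X i @^-1` [set y j i]).
have mE j : measurable (E j).
  apply: fin_bigcap_measurable => // i _.
  by rewrite -[X in measurable X]setTI; exact: mX.
under eq_bigr => j _ do rewrite -(indX (fun i => [set y j i])) //.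
have finQ : finite_set [set j | Q j] by exact: finite_finset.
have -> : (\sum_(j | Q j) Pr (E j) = Pr (\bigcup_(j in [set j | Q j]) E j))%E.
  rewrite measure_fin_bigcup //; last first.
    by move=> i j _ _ [t [ti tj]]; apply: y_inj => k; rewrite -(ti k) // -(tj k).
  rewrite (fsbigE (enum Q)) ?enum_uniq //=; last 2 first.
  - by move=> j /=; rewrite mem_enum.
  - by move=> j /= Qj; rewrite mem_enum /in_mem /= Qj.
  rewrite big_enum_cond; apply: eq_bigl => j.
  by apply/idP/andP => [Qj|[]//]; split=> //; exact/mem_set.
apply: le_measure; rewrite ?inE //.
  exact: fin_bigcup_measurable.
by move=> t [j Qj Ejt]; apply: (subA j t Qj) => i; exact: Ejt.
Qed.

(** * The two-sided geometric law on a finite window *)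

(** The integers of [[-N, N]] as zero, positives and negatives, so that negation merely swaps two
    summands. *)
Definition window (N : nat) : finType := (unit + ('I_N + 'I_N))%type.

Definition window_val N (v : window N) : int :=
  match v with
  | inl _ => 0
  | inr (inl k) => k.+1%:Z
  | inr (inr k) => - k.+1%:Z
  end.

Definition window_opp N (v : window N) : window N :=
  match v with
  | inl _ => inl tt
  | inr (inl k) => inr (inr k)
  | inr (inr k) => inr (inl k)
  end.

Lemma window_val_inj N : injective (@window_val N).
Proof.
by case=> [[]|[k|k]] [[]|[l|l]] //=; case=> /val_inj ->.
Qed.

Lemma window_oppK N : involutive (@window_opp N).
Proof. by case=> [[]|[]]. Qed.

Lemma window_val_opp N (v : window N) : window_val (window_opp v) = - window_val v.
Proof. by case: v => [[]|[k|k]] //=; rewrite ?oppr0 ?opprK. Qed.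

Lemma sum_window (R : nmodType) N (F : int -> R) :
  \sum_(v : window N) F (window_val v) =
  F 0 + \sum_(k < N) (F k.+1%:Z + F (- k.+1%:Z)).
Proof.
rewrite big_sumType /= big_sumType /= big_split /=; congr (_ + _).
by rewrite (big_pred1 tt) // => -[].
Qed.

Definition tsg_pmf (R : realFieldType) (a : R) (x : int) : R :=
  (1 - a) / (1 + a) * a ^+ `|x|%N.

Lemma tsg_pmfN (R : realFieldType) (a : R) x : tsg_pmf a (- x) = tsg_pmf a x.
Proof. by rewrite /tsg_pmf abszN. Qed.

Lemma tsg_pmf_ge0 (R : realFieldType) (a : R) x : 0 < a < 1 -> 0 <= tsg_pmf a x.
Proof.
move=> /andP[a_gt0 a_lt1]; rewrite mulr_ge0 ?exprn_ge0 ?divr_ge0 //; lra.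
Qed.

(** Each of the two tails beyond [N] has weight [a ^+ N.+1 / (1 + a)]. *)
Lemma tsg_mass (R : realFieldType) (a : R) N : 0 < a < 1 ->
  \sum_(v : window N) tsg_pmf a (window_val v) = 1 - 2 * a ^+ N.+1 / (1 + a).
Proof.
move=> /andP[a_gt0 a_lt1]; rewrite (sum_window N (tsg_pmf a)).
have a1 : 1 + a != 0 by lra.
elim: N => [|N IH]; first by rewrite big_ord0 /tsg_pmf /=; field.
rewrite big_ord_recr /= addrA IH tsg_pmfN /tsg_pmf /= !exprS; field.
exact: a1.
Qed.

(** The bound is the variance of the full law. An exact identity with an explicit nonnegative
    remainder is what goes through by induction on [N]. *)
Lemma tsg_second_moment (R : realFieldType) (a : R) N : 0 < a < 1 ->
  \sum_(v : window N) tsg_pmf a (window_val v) * (window_val v)%:~R ^+ 2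
  <= 2 * a / (1 - a) ^+ 2.
Proof.
move=> /andP[a_gt0 a_lt1].
rewrite (sum_window N (fun x => tsg_pmf a x * x%:~R ^+ 2)).
have a1 : 1 + a != 0 by lra.
have a2 : 1 - a != 0 by lra.
(* the tail [\sum_(k > N) k ^+ 2 * a ^+ k] in closed form, times [(1 - a) ^+ 3] *)
pose tail n : R :=
  a ^+ n.+1 * (n.+1%:R ^+ 2 * (1 - a) ^+ 2 + 2 * n.+1%:R * a * (1 - a) + a * (1 + a)).
suff -> : tsg_pmf a 0 * 0%:~R ^+ 2 +
   \sum_(k < N) (tsg_pmf a k.+1%:Z * k.+1%:Z%:~R ^+ 2
                + tsg_pmf a (- k.+1%:Z) * (- k.+1%:Z)%:~R ^+ 2)
   = 2 * a / (1 - a) ^+ 2 - 2 / ((1 + a) * (1 - a) ^+ 2) * tail N.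
  rewrite gerBl mulr_ge0 ?divr_ge0 ?mulr_ge0 ?exprn_ge0 //; try lra.
  rewrite !addr_ge0 ?mulr_ge0 ?exprn_ge0 ?ler0n //; lra.
elim: N => [|N IH].
  by rewrite big_ord0 /tail /=; field; rewrite a1 a2.
rewrite big_ord_recr /= addrA IH /tail tsg_pmfN /tsg_pmf /= mulrNz sqrrN -pmulrn.
rewrite !exprS -!(natr1 N.+1) -!(natr1 N); field.
by rewrite a1 a2.
Qed.

Lemma tail_mass_cvg (R : realType) (a c : R) (m : nat) : 0 < a < 1 ->
  (fun N => (1 - 2 * a ^+ N.+1 / (1 + a)) ^+ m - c) @ \oo --> 1 - c.
Proof.
move=> /andP[a_gt0 a_lt1].
have mass_cvg : (fun N => 1 - 2 * a ^+ N.+1 / (1 + a)) @ \oo --> (1 : R).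
  rewrite -[X in _ --> X]subr0; apply: cvgB; first exact: cvg_cst.
  rewrite -[X in _ --> X](mul0r (1 + a)^-1); apply: cvgMr_tmp.
  rewrite -[X in _ --> X](mulr0 2); apply: cvgMl_tmp.
  have := @cvg_expr R a; rewrite gtr0_norm // => /(_ a_lt1).
  by rewrite -(cvg_shiftS (GRing.exp a)).
apply: cvgB; last exact: cvg_cst.
have := cvg_comp _ _ mass_cvg (@exprn_continuous R m 1).
by rewrite expr1n.
Qed.

(** * Combining the two bounds *)

(** The noise failure term is [m] times the variance [2 * a / (1 - a) ^+ 2], divided by
    [2 * s ^+ 2]: Chebyshev's bound halved by symmetry. *)
Lemma prob_noisy_count_ge d (T : measurableType d) (R : realType)
  (Pr : probability T R) (n m : nat) (B G : nat -> T -> R) (p a s t : R)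
  (A : set T) :
  0 <= p <= 1 -> 0 < a < 1 -> 0 < s -> 0 <= t ->
  (forall k, measurable_fun setT (B k)) ->
  (forall l, measurable_fun setT (G l)) ->
  (forall k, (k < n)%N -> bernoulli_law Pr (B k) p) ->
  (forall l, (l < m)%N -> two_sided_geometric_law Pr (G l) a) ->
  mutually_independent Pr
    (fun i : ('I_n + 'I_m)%type =>
       match i with inl k => B (val k) | inr l => G (val l) end) ->
  measurable A ->
  (forall x, \sum_(k < n) B k x <= n%:R * (p + t) ->
     \sum_(l < m) G l x <= s -> A x) ->
  (((1 - m%:R * a / ((1 - a) ^+ 2 * s ^+ 2)) * (1 - expR (- 2 * n%:R * t ^+ 2)))%:E
    <= Pr A)%E.
Proof.
move=> p01 a01 s_gt0 t_ge0 mB mG lawB lawG ind mA subA.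
have /andP[a_gt0 a_lt1] := a01.
set c := _ / _; set h := 1 - expR _.
have h_ge0 : 0 <= h.
  by rewrite subr_ge0 -expR0 ler_expR mulNr mulNr oppr_le0 !mulr_ge0 ?exprn_ge0.
have finA : Pr A \is a fin_num by exact: fin_num_measure.
rewrite -(fineK finA) lee_fin.
(* The right-hand side does not depend on [N], so the bound survives the limit in which the
   truncated mass tends to 1. *)
suff key N : ((1 - 2 * a ^+ N.+1 / (1 + a)) ^+ m - c) * h <= fine (Pr A).
  have cv := cvgMr_tmp (b := h) (@tail_mass_cvg R a c m a01).
  apply: (cvgr_to_le (cv _)).
  by apply: nearW => N; exact: key.
pose x (v : window N) : R := (window_val v)%:~R.
pose q (v : window N) : R := tsg_pmf a (window_val v).
pose b (u : bool) : R := if u then p else 1 - p.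
have q_ge0 v : 0 <= q v by exact: tsg_pmf_ge0.
pose Wq (w : {ffun 'I_m -> window N}) := \prod_l q (w l).
have mass : \sum_v q v = 1 - 2 * a ^+ N.+1 / (1 + a) by exact: tsg_mass.
have mass1 : \sum_v q v <= 1.
  by rewrite mass gerBl divr_ge0 ?mulr_ge0 ?exprn_ge0 ?addr_ge0 // ltW.
have cheb : (1 - 2 * a ^+ N.+1 / (1 + a)) ^+ m - c
    <= \sum_(w : {ffun 'I_m -> window N} | \sum_l x (w l) <= s) Wq w.
  have total : \sum_w Wq w = (1 - 2 * a ^+ N.+1 / (1 + a)) ^+ m.
    by rewrite (sum_ffun_prod (fun _ : 'I_m => q)) mass prodr_const card_ord.
  rewrite -total lerBlDr.
  rewrite (bigID (fun w : {ffun 'I_m -> window N} => \sum_l x (w l) <= s)) /= lerD2l.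
  under eq_bigl do rewrite -ltNge.
  have := @symmetric_chebyshev R m (window N) q x (@window_opp N) s (@window_oppK N).
  have q_even v : q (window_opp v) = q v by rewrite /q window_val_opp tsg_pmfN.
  have x_odd v : x (window_opp v) = - x v by rewrite /x window_val_opp mulrNz.
  move=> /(_ q_even x_odd q_ge0 mass1 (ltW s_gt0)).
  have := ler_wpM2l (ler0n R m) (@tsg_second_moment R a N a01).
  rewrite -/(Wq _) => m2 /le_trans /(_ m2) bad.
  rewrite /c ler_pdivlMr; last by rewrite mulr_gt0 ?exprn_gt0 // subr_gt0.
  have a2 : 0 < (1 - a) ^+ 2 by rewrite exprn_gt0 // subr_gt0.
  move: bad; set S := \sum_(w | _) _ => /(ler_wpM2r (ltW a2)).
  have -> : m%:R * (2 * a / (1 - a) ^+ 2) * (1 - a) ^+ 2 = 2 * (m%:R * a).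
    by field; rewrite gt_eqF // subr_gt0.
  have -> : 2 * s ^+ 2 * S * (1 - a) ^+ 2 = 2 * (S * ((1 - a) ^+ 2 * s ^+ 2)) by ring.
  by rewrite ler_pM2l.
pose J := ({ffun 'I_n -> bool} * {ffun 'I_m -> window N})%type.
pose y (j : J) (i : 'I_n + 'I_m) : R :=
  match i with inl k => (j.1 k)%:R | inr l => x (j.2 l) end.
pose X (i : 'I_n + 'I_m) := match i with inl k => B (val k) | inr l => G (val l) end.
pose Q (j : J) := (\sum_k (j.1 k)%:R <= n%:R * (p + t)) && (\sum_l x (j.2 l) <= s).
have : (\sum_(j | Q j) \prod_i Pr (X i @^-1` [set y j i]) <= Pr A)%E.
  apply: le_sum_atoms => //.
  - by case=> i; [exact: mB|exact: mG].
  - move=> [u w] [u' w'] /= uw; congr (_, _); apply/ffunP => i.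
      by have /= /eqP := uw (inl i); rewrite eqr_nat => /eqP; case: (u i) (u' i) => [] [].
    have /= /eqP := uw (inr i); rewrite eqr_int => /eqP; exact: window_val_inj.
  - move=> [u w] z /andP[/= Qu Qw] zuw; apply: subA.
      by under eq_bigr => k _ do rewrite -[B k]/(X (inl k)) zuw.
    by under eq_bigr => l _ do rewrite -[G l]/(X (inr l)) zuw.
have -> : (\sum_(j | Q j) \prod_i Pr (X i @^-1` [set y j i]) =
    (\sum_(j | Q j) (\prod_k b (j.1 k)) * Wq j.2)%:E)%E.
  rewrite -sumEFin; apply: eq_bigr => -[u w] _.
  rewrite big_sumType /= EFinM /Wq -!prodEFin; congr (_ * _)%E; apply: eq_bigr => i _.
    have [B1 B0] := lawB _ (ltn_ord i).
    by rewrite /b; case: (u i).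
  by rewrite (lawG _ (ltn_ord i)).
rewrite -{1}(fineK finA) lee_fin; apply: le_trans.
(* [Q] constrains the two components separately, so the sum over pairs is a product of sums. *)
rewrite (_ : \sum_(j | Q j) _ =
  (\sum_(u : {ffun 'I_n -> bool} | \sum_k (u k)%:R <= n%:R * (p + t))
     \prod_k b (u k)) *
  (\sum_(w : {ffun 'I_m -> window N} | \sum_l x (w l) <= s) Wq w)); last first.
  by rewrite big_distrlr pair_big.
(* The left side of [cheb] may be negative, so [cheb] is first multiplied by [h >= 0]; Hoeffding's
   bound then replaces [h] against a nonnegative weight. *)
rewrite [leRHS]mulrC; apply: le_trans (ler_wpM2r h_ge0 cheb) _.
apply: ler_wpM2l; first by apply: sumr_ge0 => w _; exact: prodr_ge0.
exact: hoeffding_bernoulli.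
Qed.

Theorem theorem3 (d : measure_display) (T : measurableType d) (R : realType)
  (Pr : probability T R)
  (f eps : R) (K P : nat) (eta_g eta_s fc : R) (m : nat)
  (B G : nat -> T -> R) :
  0 < f < 1 -> 0 < eps -> (1 <= K)%N -> (1 <= P)%N ->
  0 < eta_g < 1 -> 0 < eta_s < 1 -> 0 <= fc <= 1 -> (1 <= m)%N ->
  (forall k, measurable_fun setT (B k)) ->
  (forall l, measurable_fun setT (G l)) ->
  (forall k, (k < P * m)%N -> bernoulli_law Pr (B k) fc) ->
  (forall l, (l < m)%N -> two_sided_geometric_law Pr (G l) (expR (- (eps / K%:R)))) ->
  mutually_independent Pr
    (fun i : ('I_(P * m) + 'I_m)%type =>
       match i with inl k => B (val k) | inr l => G (val l) end) ->
  let alpha := expR (- (eps / K%:R)) in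
  let n := (P * m)%N in
  let r := fun t => \sum_(k < n) B k t + \sum_(l < m) G l t in
  let bound := fun t =>
    r t / n%:R
    - Num.sqrt (2 * alpha / (2 * (1 - alpha) ^+ 2 * P%:R ^+ 2 * m%:R * eta_g))
    - Num.sqrt (ln eta_s / (- 2 * n%:R)) in
  (((1 - eta_g) * (1 - eta_s))%:E <= Pr [set t | (bound t <= fc)%R])%E /\
  (((1 - eta_g) * (1 - eta_s))%:E <= Pr [set t | (f <= bound t)%R -> (f <= fc)%R])%E.
Proof.
move=> /andP[_ f_lt1] eps_gt0 K_gt0 P_gt0 /andP[eg_gt0 eg_lt1] /andP[es_gt0 es_lt1].
move=> fc01 m_gt0 mB mG lawB lawG ind alpha n r bound.
have alpha_gt0 : 0 < alpha by exact: expR_gt0.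
have alpha_lt1 : alpha < 1.
  by rewrite /alpha -[ltRHS]expR0 ltr_expR oppr_lt0 divr_gt0 // ltr0n.
have P_gt0R : 0 < P%:R :> R by rewrite ltr0n.
have m_gt0R : 0 < m%:R :> R by rewrite ltr0n.
have nE : n%:R = P%:R * m%:R :> R by rewrite natrM.
have n_gt0 : 0 < n%:R :> R by rewrite nE mulr_gt0.
set noise := Num.sqrt (2 * alpha / _) in bound *.
set dev := Num.sqrt (ln eta_s / _) in bound *.
have mr : measurable_fun setT r.
  by apply: measurable_funD; apply: measurable_sum => i.
have mbound : measurable_fun setT bound.
  do 2!(apply: measurable_funB; last exact: measurable_cst).
  by apply: measurable_funM => //; exact: measurable_cst.
have alphaB : 0 < (1 - alpha) ^+ 2 by rewrite exprn_gt0 // subr_gt0.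
have den_gt0 : 0 < 2 * (1 - alpha) ^+ 2 * P%:R ^+ 2 * m%:R * eta_g.
  by rewrite !mulr_gt0 ?exprn_gt0 // subr_gt0.
have noise_gt0 : 0 < noise by rewrite sqrtr_gt0 divr_gt0 // mulr_gt0.
(* The threshold [s = n * noise] makes the Chebyshev failure term exactly [eta_g]; the 2 in the
   denominator of [noise] is the gain from symmetry. *)
have noise2 : m%:R * alpha / ((1 - alpha) ^+ 2 * (n%:R * noise) ^+ 2) = eta_g.
  rewrite exprMn sqr_sqrtr; last by rewrite ltW // -sqrtr_gt0.
  by rewrite nE; field; rewrite !gt_eqF //= subr_gt0.
(* Numerator and denominator under the root in [dev] are both nonpositive, so the root is genuine
   and not the default 0. *)
have dev2 : expR (- 2 * n%:R * dev ^+ 2) = eta_s.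
  have n2 : - 2 * n%:R < 0 :> R by rewrite mulNr oppr_lt0 mulr_gt0.
  rewrite sqr_sqrtr; last by rewrite ler_ndivlMr // mul0r ln_le0 // ltW.
  by rewrite mulrCA divff ?lt_eqF // mulr1 lnK.
have mle : measurable [set t | bound t <= fc].
  have := mbound measurableT _ (measurable_itv `]-oo, fc]).
  by rewrite setTI; congr measurable; apply/seteqP; split=> z /=; rewrite in_itv.
have bound_le : (((1 - eta_g) * (1 - eta_s))%:E <= Pr [set t | (bound t <= fc)%R])%E.
  have := prob_noisy_count_ge (s := n%:R * noise) (t := dev) fc01 _ _ _ mB mG lawB lawG ind mle.
  rewrite noise2 dev2; apply; rewrite ?alpha_gt0 ?mulr_gt0 ?sqrtr_ge0 // => z Bz Gz.
  rewrite /bound /r /= 2!lerBlDr mulrDl.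
  have : (\sum_(k < n) B k z) / n%:R <= fc + dev by rewrite ler_pdivrMr // mulrC.
  have : (\sum_(l < m) G l z) / n%:R <= noise by rewrite ler_pdivrMr // mulrC.
  lra.
split=> //; apply: le_trans bound_le _.
(* [fc] is not random: if [f <= fc] the event is everything, and otherwise it is [bound t < f],
   which contains [bound t <= fc]. *)
have [ffc|fcf] := leP f fc.
  rewrite [X in (_ <= Pr X)%E](_ : _ = setT).
    by rewrite probability_setT probability_le1.
  by apply/seteqP; split.
apply: le_measure; rewrite ?inE //.
  have := mbound measurableT _ (measurable_itv `]-oo, f[).
  rewrite setTI; congr measurable; apply/seteqP; split=> z /=; rewrite in_itv /=.
    by rewrite ltNge => /negP.
  by move=> H; rewrite ltNge; apply/negP => /H.
by move=> z /= bz fb; have := le_trans fb bz; rewrite leNgt fcf.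
Qed.
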